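(* Let $V=\mathbb{C}^n$ and let $A$ be a commutative (not necessarily associative, not necessarily unital) algebra structure on $V$, i.e. a point of $\mathcal{A}=S^2V^*\otimes V$. Suppose $A\notin\mathcal{D}_1\cup\mathcal{D}_2$. Then $A$ has no nonzero quasiderivations: $Q\mathrm{Der}(A)=0$.
   Context: $\mathcal{D}_1\subset\mathcal{A}$ is the set of algebras containing a quadratic nilpotent, i.e. a nonzero $v$ with $v^2=0$. A one-dimensional subalgebra $U\subset A$ is singular if there exist linearly independent $u\in U$, $v\in A$ and $\alpha\in\mathbb{C}$ with $u^2=\alpha u$ and $uv=\frac{\alpha}{2}v$; $\mathcal{D}_2\subset\mathcal{A}$ is the set of algebras containing a singular one-dimensional subalgebra. The Lie algebra $\mathfrak{gl}(V)$ acts on bilinear multiplications $\mu$ by $(D\cdot\mu)(x,y)=D(\mu(x,y))-\mu(Dx,y)-\mu(x,Dy)$. A linear operator $D\in\mathrm{End}(V)$ is a quasiderivation of $A=(V,\mu)$ if $D\cdot(D\cdot\mu)=0$; $Q\mathrm{Der}(A)$ denotes the set of quasiderivations. *)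

(* Defs.v *)
From HB Require Import structures.
From mathcomp Require Import all_boot all_algebra complex reals.
Set Implicit Arguments. Unset Strict Implicit. Unset Printing Implicit Defensive.
Import GRing.Theory Num.Theory.
Local Open Scope ring_scope.

(* The complex numbers are modelled as R[i] for R : realType (the reals).
   V = C^n is 'rV[R[i]]_n; linear operators act on row vectors by x *m D. *)

Section Defs.
Variables (F : fieldType) (n : nat).
Notation V := 'rV[F]_n.

Definition bilinear_mul (mu : V -> V -> V) : Prop :=
  (forall a x y z, mu (a *: x + y) z = a *: mu x z + mu y z) /\
  (forall a x y z, mu x (a *: y + z) = a *: mu x y + mu x z).

Definition commutative_mul (mu : V -> V -> V) : Prop :=
  forall x y, mu x y = mu y x.

Definition gl_act (D : 'M[F]_n) (mu : V -> V -> V) : V -> V -> V :=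
  fun x y => mu x y *m D - mu (x *m D) y - mu x (y *m D).

Definition quasiderivation (mu : V -> V -> V) (D : 'M[F]_n) : Prop :=
  forall x y, gl_act D (gl_act D mu) x y = 0.

Definition in_D1 (mu : V -> V -> V) : Prop :=
  exists v : V, v != 0 /\ mu v v = 0.

Definition one_dim_subalgebra (mu : V -> V -> V) (U : {vspace V}) : Prop :=
  \dim U = 1%N /\ (forall x y, x \in U -> y \in U -> mu x y \in U).

Definition singular_subalgebra (mu : V -> V -> V) (U : {vspace V}) : Prop :=
  one_dim_subalgebra mu U /\
  exists (u v : V) (alpha : F),
    [/\ u \in U, free [:: u; v], mu u u = alpha *: u
      & mu u v = (alpha / 2%:R) *: v].

Definition in_D2 (mu : V -> V -> V) : Prop :=
  exists U : {vspace V}, singular_subalgebra mu U.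

End Defs.

(* Main.v *)
Require Import Defs.
From HB Require Import structures.
From mathcomp Require Import all_boot all_order all_algebra complex reals.
From mathcomp Require Import boolp classical_sets mpoly zify ring lra.
Set Implicit Arguments. Unset Strict Implicit. Unset Printing Implicit Defensive.
Import Order.TTheory GRing.Theory Num.Theory.
Local Open Scope ring_scope.

(* Put [om = D . mu], so that [D] is a derivation of [om].
   - If [x] is an eigenvector of [D] for [a <> 0] and [2a] is not an eigenvalue,
     then [(D - 2a)^2 (x x) = 0] forces [x x = 0]; hence [D] is nilpotent.
   - Let [D^k] be the last nonzero power.  If [k >= 2], applying [D^(2k)] to
     [x x] leaves only [C(2k, k) (D^k x)(D^k x) = 0], so [D^2 = 0].
   - If [D^2 = 0] then [(Dx)(Dy) = D ((Dx) y + x (Dy))], so the image of [D] is a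
     subalgebra, and an idempotent [e = Dx] in it satisfies [e = 2 D (e x)]: the
     class of [x] modulo [ker D] is an eigenvector of multiplication by [e] for
     [1/2], which contradicts [A] not being in [D_2].
   - Idempotents exist in any nonzero algebra without square-zero elements.
     Otherwise the cubic forms [x_k q_j - x_j q_k] have no common zero, and the
     Nullstellensatz gives an elimination of all monomials of some degree, which
     persists along the line from [(x_i ^ 2)_i] to [q] for a generic parameter
     [t].  But Hensel's lemma extends the idempotent [(1, ..., 1)] at [t = 0] to
     a formal one along this line. *)

(** * Leibniz expansions for the iterates of an additive map *)

Fixpoint leibniz_sum {V : zmodType} (d : V -> V) (nu : V -> V -> V) (m : nat)
    (x y : V) : V :=
  if m is m'.+1 then leibniz_sum d nu m' (d x) y + leibniz_sum d nu m' x (d y)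
  else nu x y.

Section Leibniz.
Variables (V : zmodType) (d : V -> V) (nu : V -> V -> V).
Hypotheses (dD : {morph d : x y / x + y}) (d0 : d 0 = 0).
Hypotheses (nu0x : forall x, nu 0 x = 0) (nux0 : forall x, nu x 0 = 0).

Let iterD m x y : iter m d (x + y) = iter m d x + iter m d y.
Proof. by elim: m => // m IHm; rewrite !iterS IHm dD. Qed.

(** The defect [om] can enter at any of the [m.+1] applications of [d]; as [d] is a derivation of
    [om], each entry contributes the same term. *)
Lemma iter_quasiderivation (om : V -> V -> V) :
  (forall x y, d (nu x y) = nu (d x) y + nu x (d y) + om x y) ->
  (forall x y, d (om x y) = om (d x) y + om x (d y)) ->
  forall m x y, iter m.+1 d (nu x y)
    = leibniz_sum d nu m.+1 x y + iter m d (om x y) *+ m.+1.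
Proof.
move=> dnu dom m x y; suff gen : forall m x y, iter m d (nu x y)
    = leibniz_sum d nu m x y + iter m.-1 d (om x y) *+ m by rewrite gen.
elim=> {m x y} [|m IHm] x y; first by rewrite mulr0n addr0.
rewrite iterSr dnu !iterD !IHm [leibniz_sum _ _ m.+1 _ _]/= succnK.
rewrite [X in X + _ = _]addrACA -[LHS]addrA; congr (_ + _).
rewrite -mulrnDl -iterD -dom mulrSr; congr (_ + _).
by case: m {IHm} => [|m]; rewrite ?mulr0n //= -iterSr.
Qed.

(** A term with [d] applied [a] times to [x] and [b] times to [y], where [a + b = k + k], vanishes
    unless [a = b = k]; [c] counts the surviving terms. *)
Lemma leibniz_sum_middle (k : nat) :
  (forall x, iter k.+1 d x = 0) ->
  forall x y, exists2 c, (0 < c)%N &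
    leibniz_sum d nu (k + k) x y = nu (iter k d x) (iter k d y) *+ c.
Proof.
move=> dk x y.
have sum0 m : (forall z, leibniz_sum d nu m 0 z = 0)
    /\ (forall z, leibniz_sum d nu m z 0 = 0).
  elim: m => [|m [IH1 IH2]]; first by split.
  by split=> z /=; rewrite d0 ?IH1 ?IH2 addr0.
suff gen m a b : (m + (a + b) = k + k)%N -> (a <= k)%N -> (b <= k)%N ->
    exists2 c, (0 < c)%N & leibniz_sum d nu m (iter a d x) (iter b d y)
                          = nu (iter k d x) (iter k d y) *+ c.
  by apply: (gen (k + k)%N 0%N 0%N); rewrite ?addn0.
elim: m a b => [|m IHm] a b Eab ak bk.
  have [-> ->] : a = k /\ b = k.
    by move: Eab ak bk; rewrite add0n => *; split; lia.
  by exists 1%N; rewrite ?mulr1n.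
rewrite /= -!iterS.
have [Ea|ak'] := eqVneq a k.
  rewrite Ea dk (sum0 m).1 add0r; apply: IHm; lia.
have [|||c1 c1_gt0 ->] := IHm a.+1 b; [lia|lia|lia|].
have [Eb|bk'] := eqVneq b k.
  by rewrite Eb dk (sum0 m).2 addr0; exists c1.
have [|||c2 c2_gt0 ->] := IHm a b.+1; [lia|lia|lia|].
by exists (c1 + c2)%N; rewrite ?mulrnDr // addn_gt0 c1_gt0.
Qed.

End Leibniz.

(** * Bilinear multiplications and the action of matrices on them *)

Section BilinearMul.
Variables (F : fieldType) (n : nat) (mu : 'rV[F]_n -> 'rV[F]_n -> 'rV[F]_n).
Hypothesis mu_bil : bilinear_mul mu.

Lemma bilinear_mulDl x y z : mu (x + y) z = mu x z + mu y z.
Proof. by have := mu_bil.1 1 x y z; rewrite !scale1r. Qed.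

Lemma bilinear_mulDr z x y : mu z (x + y) = mu z x + mu z y.
Proof. by have := mu_bil.2 1 z x y; rewrite !scale1r. Qed.

Lemma bilinear_mul0l z : mu 0 z = 0.
Proof. by apply: (addIr (mu 0 z)); rewrite -bilinear_mulDl !add0r. Qed.

Lemma bilinear_mul0r z : mu z 0 = 0.
Proof. by apply: (addIr (mu z 0)); rewrite -bilinear_mulDr !add0r. Qed.

Lemma bilinear_mulZl a x z : mu (a *: x) z = a *: mu x z.
Proof. by have := mu_bil.1 a x 0 z; rewrite bilinear_mul0l !addr0. Qed.

Lemma bilinear_mulZr a x z : mu z (a *: x) = a *: mu z x.
Proof. by have := mu_bil.2 a z x 0; rewrite bilinear_mul0r !addr0. Qed.

Lemma bilinear_mul_suml (I : finType) (f : I -> 'rV[F]_n) z :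
  mu (\sum_i f i) z = \sum_i mu (f i) z.
Proof.
exact: (big_morph (mu^~ z) (fun x y => bilinear_mulDl x y z) (bilinear_mul0l z)).
Qed.

Lemma bilinear_mul_sumr (I : finType) (f : I -> 'rV[F]_n) z :
  mu z (\sum_i f i) = \sum_i mu z (f i).
Proof. exact: (big_morph (mu z) (bilinear_mulDr z) (bilinear_mul0r z)). Qed.

Variable D : 'M[F]_n.

Lemma gl_actE x y :
  mu x y *m D = mu (x *m D) y + mu x (y *m D) + gl_act D mu x y.
Proof. by rewrite /gl_act [RHS]addrC -(addrA (mu x y *m D)) -opprD subrK. Qed.

Lemma bilinear_gl_act : bilinear_mul (gl_act D mu).
Proof.
have opA (u1 u2 u3 v1 v2 v3 : 'rV[F]_n) :
  (u1 + v1) - (u2 + v2) - (u3 + v3) = (u1 - u2 - u3) + (v1 - v2 - v3).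
  by rewrite !opprD (addrACA u1) (addrACA (u1 - u2)).
by split=> a x y z;
  rewrite /gl_act !(mulmxDl, =^~ scalemxAl, bilinear_mulDl, bilinear_mulDr,
    bilinear_mulZl, bilinear_mulZr) opA !scalerBr.
Qed.

End BilinearMul.

(** * Eigenvalues and nilpotency of a quasiderivation *)

Section Quasiderivation.
Variables (F : numClosedFieldType) (n : nat).
Variables (mu : 'rV[F]_n -> 'rV[F]_n -> 'rV[F]_n) (D : 'M[F]_n).
Hypotheses (mu_bil : bilinear_mul mu) (D_quasi : quasiderivation mu D).
Hypothesis mu_aniso : forall v, mu v v = 0 -> v = 0.

Lemma gl_act_derivation x y :
  gl_act D mu x y *m D = gl_act D mu (x *m D) y + gl_act D mu x (y *m D).
Proof. by rewrite gl_actE D_quasi addr0. Qed.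

Lemma quasiderivation_eigen a (x : 'rV[F]_n) :
  x *m D = a *: x -> ~~ eigenvalue D (a *+ 2) -> x = 0.
Proof.
move=> Dx Na; apply: mu_aniso.
have eig0 (v : 'rV[F]_n) : v *m D = (a *+ 2) *: v -> v = 0.
  move=> Dv; apply: contraNeq Na => v_n0; apply/eigenvalueP.
  by exists v.
have om_bil := bilinear_gl_act mu_bil D.
have om0 : gl_act D mu x x = 0.
  apply: eig0; rewrite gl_act_derivation Dx.
  by rewrite (bilinear_mulZl om_bil) (bilinear_mulZr om_bil)
    -scalerDl mulr2n.
apply: eig0; rewrite gl_actE om0 addr0 Dx.
by rewrite (bilinear_mulZl mu_bil) (bilinear_mulZr mu_bil)
  -scalerDl mulr2n.
Qed.

(** A nonzero eigenvalue [a] would make every [a *+ 2 ^ j] an eigenvalue. These are distinct in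
    characteristic 0, hence too many for [char_poly D]. *)
Lemma quasiderivation_eigenvalue0 a : eigenvalue D a -> a = 0.
Proof.
move=> Da; apply: contraTeq isT => a_n0.
have Dpow j : eigenvalue D (a *+ 2 ^ j).
  elim: j => // j IHj; rewrite expnSr mulrnA; apply: contraT => Nj.
  have /eigenvalueP[v Dv /eqP[]] := IHj.
  exact: quasiderivation_eigen Dv Nj.
have P_n0 : char_poly D != 0 by rewrite monic_neq0 ?char_poly_monic.
have := max_poly_roots (rs := [seq a *+ 2 ^ j | j <- iota 0 n.+1]) P_n0.
rewrite size_map size_iota size_char_poly ltnn; apply=> //.
  by apply/allP=> _ /mapP[j _ ->]; rewrite -eigenvalue_root_char.
rewrite map_inj_uniq ?iota_uniq // => i j /eqP.
by rewrite -!(mulr_natr a) (inj_eq (mulfI a_n0)) eqr_nat eqn_exp2l // => /eqP.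
Qed.

End Quasiderivation.

Section QuasiderivationNilpotent.
Variables (F : numClosedFieldType) (n : nat).
Variables (mu : 'rV[F]_n.+1 -> 'rV[F]_n.+1 -> 'rV[F]_n.+1) (D : 'M[F]_n.+1).
Hypotheses (mu_bil : bilinear_mul mu) (D_quasi : quasiderivation mu D).
Hypothesis mu_aniso : forall v, mu v v = 0 -> v = 0.

Lemma quasiderivation_nilpotent : exists m, D ^+ m = 0.
Proof.
have [r Dr] := closed_field_poly_normal (char_poly D).
rewrite (monicP (char_poly_monic D)) scale1r in Dr.
exists (size r); have := Cayley_Hamilton D; rewrite Dr.
rewrite (eq_big_seq (fun => 'X)) => [|z rz].
  by rewrite big_const_seq count_predT iter_mulr_1 rmorphXn /= horner_mx_X.
have -> : z = 0.
  apply: (quasiderivation_eigenvalue0 mu_bil D_quasi mu_aniso).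
  by rewrite eigenvalue_root_char Dr root_prod_XsubC.
by rewrite subr0.
Qed.

Lemma quasiderivation_sqr0 : D *m D = 0.
Proof.
have exD : exists m, D ^+ m == 0.
  by have [m /eqP] := quasiderivation_nilpotent; exists m.
pose d (x : 'rV[F]_n.+1) := x *m D.
have iterE m x : iter m d x = x *m D ^+ m.
  elim: m => [|m IHm]; first by rewrite expr0 mulmx1.
  by rewrite iterS IHm /d -mulmxA exprSr.
case: (ex_minnP exD) => [[|[|[|k]]]] /eqP Dm minm.
- by move/eqP: Dm; rewrite expr0 oner_eq0.
- by rewrite -[D]expr1 Dm mul0mx.
- by rewrite -Dm expr2.
have w0 (x : 'rV[F]_n.+1) : x *m D ^+ k.+2 = 0.
  apply: mu_aniso; rewrite -iterE.
  have dk z : iter k.+3 d z = 0 by rewrite iterE Dm mulmx0.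
  have dbig m z : (k.+3 <= m)%N -> iter m d z = 0.
    by move=> km; rewrite iterE -(subnK km) exprD Dm mulr0 mulmx0.
  have dD : {morph d : x y / x + y} by move=> y z; rewrite /d mulmxDl.
  have [|||c c_gt0 Ec] := @leibniz_sum_middle _ d mu _ _ _ _ dk x x.
  - by rewrite /d mul0mx.
  - by apply: bilinear_mul0l.
  - by apply: bilinear_mul0r.
  (* At the exponent [2 (k + 2)] the left side vanishes, and so does the [om] term, which still
     carries [2 k + 3 >= k + 3] factors [D]. *)
  have := iter_quasiderivation dD (gl_actE mu D)
    (gl_act_derivation D_quasi) (k.+1 + k.+2)%N x x.
  rewrite (dbig (k.+1 + k.+2).+1) ?(dbig (k.+1 + k.+2)%N); [|lia..].
  rewrite mul0rn addr0 -addSn Ec => /esym/eqP.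
  by rewrite -scaler_nat scaler_eq0 pnatr_eq0 eqn0Ngt c_gt0 => /eqP.
suff /minm : D ^+ k.+2 == 0 by rewrite ltnn.
by apply/eqP/row_matrixP=> i; rewrite rowE w0 row0.
Qed.

End QuasiderivationNilpotent.

(** * Quasiderivations of square zero and singular subalgebras *)

Section SquareZero.
Variables (F : numFieldType) (n : nat).
Variables (mu : 'rV[F]_n -> 'rV[F]_n -> 'rV[F]_n) (D : 'M[F]_n).
Hypotheses (mu_bil : bilinear_mul mu) (mu_comm : commutative_mul mu).
Hypotheses (D_quasi : quasiderivation mu D) (D2 : D *m D = 0).

(** Expanding [D . (D . mu)] and deleting the terms with [D *m D] leaves twice the difference of the
    two sides. *)
Lemma quasiderivation_sqr0_mul x y :
  mu (x *m D) (y *m D) = (mu (x *m D) y + mu x (y *m D)) *m D.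
Proof.
have DD (z : 'rV[F]_n) : z *m D *m D = 0 by rewrite -mulmxA D2 mulmx0.
have /eqP := D_quasi x y; rewrite /gl_act !mulmxBl !DD.
rewrite (bilinear_mul0l mu_bil) (bilinear_mul0r mu_bil) mulmxDl.
set A := mu (x *m D) y *m D; set B := mu x (y *m D) *m D; set P := mu _ _.
have -> : 0 - A - B - (A - 0 - P) - (B - P - 0) = 2 *: (P - (A + B)).
  by move: A B P => A B P; apply/rowP=> j; rewrite !mxE; ring.
by rewrite scaler_eq0 pnatr_eq0 subr_eq0 => /eqP.
Qed.

Lemma image_idempotent_in_D2 x :
  x *m D != 0 -> mu (x *m D) (x *m D) = x *m D -> in_D2 mu.
Proof.
set e := x *m D => e_n0 ee.
have ex : e = 2 *: (mu e x *m D).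
  rewrite scaler_nat mulr2n -mulmxDl -{1}ee /e quasiderivation_sqr0_mul.
  by rewrite (mu_comm x).
have eK z : z *m D = 0 -> mu e z *m D = 0.
  move=> zD; have := quasiderivation_sqr0_mul x z.
  by rewrite zD !(bilinear_mul0r mu_bil) addr0.
(* [f] maps [ker D] into itself and also sends [x], which lies outside, into [ker D]. So [f] is
   singular, and its kernel consists of the [v] with [e v = v / 2]. *)
pose f z := 2 *: mu e z - z.
have f_lin : linear f.
  move=> a u v; rewrite /f (bilinear_mulDr mu_bil) (bilinear_mulZr mu_bil).
  by rewrite scalerBr scalerDr !scalerA (mulrC 2) opprD addrACA.
pose fL : {linear 'rV[F]_n -> 'rV[F]_n} :=
  HB.pack f (GRing.isLinear.Build F _ _ _ f f_lin).
pose L := lin1_mx fL.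
have LE z : z *m L = f z by rewrite (mul_rV_lin1 fL).
have LK : (kermx D *m L <= kermx D)%MS.
  apply/row_subP=> i; rewrite row_mul LE; apply/sub_kermxP.
  have kD : row i (kermx D) *m D = 0 by rewrite -row_mul mulmx_ker row0.
  by rewrite mulmxBl -scalemxAl eK // kD scaler0 subr0.
have xL : (x *m L <= kermx D)%MS.
  by apply/sub_kermxP; rewrite LE mulmxBl -scalemxAl -ex subrr.
have L_sing : ~~ row_free L.
  apply: contra e_n0 => L_free; apply/eqP/sub_kermxP.
  have KL : (kermx D <= kermx D *m L)%MS.
    by rewrite -(geq_leqif (mxrank_leqif_sup LK)) mxrankMfree.
  by rewrite -(submxMfree _ _ L_free); apply: submx_trans KL.
have [v vL v_n0] : exists2 v : 'rV[F]_n, v *m L = 0 & v != 0.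
  have : kermx L != 0 by rewrite kermx_eq0.
  by case/rowV0Pn=> v /sub_kermxP; exists v.
have ev : mu e v = (1 / 2) *: v.
  have /eqP := vL; rewrite LE subr_eq0 => /eqP {2}<-.
  by rewrite scalerA mul1r mulVf ?pnatr_eq0 // scale1r.
exists <[e]>%VS; split.
  split; first by rewrite dim_vline e_n0.
  move=> _ _ /vlineP[a ->] /vlineP[b ->]; apply/vlineP; exists (a * b).
  by rewrite (bilinear_mulZl mu_bil) (bilinear_mulZr mu_bil) ee scalerA.
exists e, v, 1; rewrite memv_line scale1r ee ev; split => //.
(* If [e = c *: v], then [e e] would be both [e] and [e / 2]. *)
rewrite free_cons span_seq1 seq1_free v_n0 andbT; apply/vlineP => -[c ec].
have /eqP : mu e e = (1 / 2) *: e.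
  by rewrite {2 3}ec (bilinear_mulZr mu_bil) ev !scalerA mulrC.
rewrite ee -subr_eq0 -{1}[e]scale1r -scalerBl scaler_eq0 (negPf e_n0) orbF.
have -> : 1 - 1 / 2 = 1 / 2 :> F by field.
by rewrite mul1r invr_eq0 pnatr_eq0.
Qed.

End SquareZero.

(** * Weak Nullstellensatz over an uncountable field *)

(** Uncountability in finitary form: cutting [T] into countably many levels leaves an infinite part
    below one of them. *)
Definition large_fibers (T : eqType) := forall g : T -> nat,
  exists d, forall N, exists s : seq T,
    [/\ uniq s, size s = N & forall a, a \in s -> (g a <= d)%N].

Definition is_ideal (A : comNzRingType) (J : A -> Prop) :=
  [/\ J 0, forall f g, J f -> J g -> J (f + g) & forall h f, J f -> J (h * f)].

Definition ideal_adjoin (A : comNzRingType) (J : A -> Prop) (p : A) : A -> Prop :=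
  fun f => exists h, J (f - h * p).

Section Ideals.
Variables (A : comNzRingType) (J : A -> Prop).
Hypothesis J_ideal : is_ideal J.

Lemma ideal_sum (I : finType) (f : I -> A) :
  (forall i, J (f i)) -> J (\sum_i f i).
Proof.
case: J_ideal => J0 JD _ Jf.
by apply: (big_ind J) => // i _.
Qed.

Lemma ideal_adjoin_ideal p : is_ideal (ideal_adjoin J p).
Proof.
case: J_ideal => J0 JD JM; split.
- by exists 0; rewrite mul0r subr0.
- move=> f g [h1 Jh1] [h2 Jh2]; exists (h1 + h2).
  by have := JD _ _ Jh1 Jh2; congr J; ring.
- move=> h f [h1 Jh1]; exists (h * h1).
  by have := JM h _ Jh1; congr J; ring.
Qed.

Lemma ideal_adjoin_sub p f : J f -> ideal_adjoin J p f.
Proof. by exists 0; rewrite mul0r subr0. Qed.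

Lemma ideal_adjoin_gen p : ideal_adjoin J p p.
Proof. by exists 1; rewrite mul1r subrr; case: J_ideal. Qed.

End Ideals.

Section Nullstellensatz.
Variables (F : closedFieldType) (n : nat).
Hypothesis F_large : large_fibers F.
Notation A := {mpoly F[n]}.

Lemma mpoly_lindep (N d : nat) (b : 'I_N -> A) :
  (forall k, msize (b k) <= d)%N -> (#|{: 'X_{1..n < d}}| < N)%N ->
  exists2 c : 'rV[F]_N, c != 0 & \sum_k c 0 k *: b k = 0.
Proof.
move=> b_d N_big.
pose M := \matrix_(k < N, j < #|{: 'X_{1..n < d}}|) (b k)@_(enum_val j : 'X_{1..n < d}).
have : kermx M != 0.
  rewrite -mxrank_eq0 mxrank_ker subn_eq0 -ltnNge.
  exact: leq_ltn_trans (rank_leq_col M) N_big.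
case/rowV0Pn=> c /sub_kermxP cM c_n0; exists c => //.
rewrite (eq_bigr (fun k => \sum_(m : 'X_{1..n < d})
    (c 0 k * (b k)@_m) *: ('X_[m] : A))) => [|k _]; last first.
  rewrite {1}(mpolywE (b_d k)) scaler_sumr.
  by apply: eq_bigr => m _; rewrite scalerA.
rewrite exchange_big big1 //= => m _; rewrite -scaler_suml.
have /rowP/(_ (enum_rank m)) := cM; rewrite !mxE => cm0.
rewrite [X in X *: _](_ : _ = 0) ?scale0r // -[RHS]cm0.
by apply: eq_bigr => k _; rewrite mxE enum_rankK.
Qed.

(* The inverses of [x - a] modulo [J], for uncountably many [a], are linearly
   dependent, which yields a nonzero polynomial in [x] alone that lies in [J];
   its linear factors cannot all be invertible. *)
Lemma ideal_adjoin_proper (J : A -> Prop) (x : A) :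
  is_ideal J -> ~ J 1 -> exists a, ~ ideal_adjoin J (x - a%:A) 1.
Proof.
move=> J_ideal J1; apply: contrapT => /forallNP noa.
have [J0 JD JM] := J_ideal.
have inv a : exists h, J (1 - h * (x - a%:A)) := contrapT (noa a).
have [b Jb] := choice inv.
have [d d_large] := F_large (fun a => msize (b a)).
have [s [s_uniq s_size s_d]] := d_large #|{: 'X_{1..n < d}}|.+1.
set N := #|_|.+1 in s_size.
pose r (k : 'I_N) := s`_k.
have r_s k : r k \in s by rewrite mem_nth ?s_size.
have r_inj : injective r.
  by move=> i j /eqP; rewrite nth_uniq ?s_size // => /eqP/val_inj.
have [c c_n0 cb0] := @mpoly_lindep N d (fun k => b (r k))
  (fun k => s_d _ (r_s k)) (leqnn _).
(* The numerator of [\sum_k c_k / ('X - r_k)]; its value at [r_k] is [c_k] times a nonzero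
   product. *)
pose f : {poly F} := \sum_k c 0 k *: \prod_(l | l != k) ('X - (r l)%:P).
have f_n0 : f != 0.
  have [k ck] := rV0Pn _ c_n0.
  apply: contra_neq ck => f0; have := congr1 (horner^~ (r k)) f0.
  rewrite horner0 horner_sum (bigD1 k) //= [X in _ + X]big1 => [|j jk].
    rewrite addr0 hornerZ horner_prod => /eqP; rewrite mulf_eq0 => /orP[/eqP//|].
    rewrite prodf_seq_eq0 => /hasP[l _ /andP[lk]].
    rewrite hornerXsubC subr_eq0 => /eqP/r_inj kl.
    by rewrite kl eqxx in lk.
  rewrite hornerZ horner_prod (bigD1 k) 1?eq_sym //=.
  by rewrite hornerXsubC subrr mul0r mulr0.
have rhoX a : horner_alg x ('X - a%:P) = x - a%:A.
  by rewrite rmorphB /= horner_algX horner_algC.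
have Jf : J (horner_alg x f).
  pose P k := \prod_(l | l != k) (x - (r l)%:A).
  have -> : horner_alg x f = \sum_k c 0 k *: P k.
    rewrite rmorph_sum; apply: eq_bigr => k _ /=.
    rewrite linearZ rmorph_prod /= mulr_algl; congr (_ *: _).
    by apply: eq_bigr => l _; rewrite rhoX.
  (* The subtracted part is [\prod_l (x - r_l)] times [\sum_k c_k b(r_k) = 0], and each new summand
     lies in [J]. *)
  have -> : \sum_k c 0 k *: P k =
      \sum_k c 0 k *: (P k * (1 - b (r k) * (x - (r k)%:A))).
    apply/eqP; rewrite -subr_eq0 -sumrB; apply/eqP.
    transitivity (\prod_l (x - (r l)%:A) * \sum_k c 0 k *: b (r k)); last first.
      by rewrite cb0 mulr0.
    rewrite mulr_sumr; apply: eq_bigr => k _.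
    rewrite -scalerBr -scalerAr; congr (_ *: _).
    by rewrite (bigD1 k) //=; rewrite -/(P k); ring.
  apply: (ideal_sum J_ideal) => k.
  by rewrite scalerAl; apply: JM.
have [t ft] := closed_field_poly_normal f.
have Jt : J (\prod_(z <- t) (x - z%:A)).
  have -> : \prod_(z <- t) (x - z%:A) = (lead_coef f)^-1 *: horner_alg x f.
    rewrite {2}ft linearZ /= mulr_algl scalerA mulVf ?lead_coef_eq0 // scale1r
      rmorph_prod.
    by apply: eq_bigr => z _; rewrite /= rhoX.
  by have := JM (lead_coef f)^-1%:A _ Jf; rewrite mulr_algl.
(* Each factor [x - z] is invertible modulo [J] and cancels, until the empty product 1 is left in
   [J]. *)
apply: J1; elim: t Jt {ft} => [|z t IHt]; first by rewrite big_nil.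
rewrite big_cons; set q := \prod_(_ <- _) _ in IHt * => Jq; apply: IHt.
by have := JD _ _ (JM q _ (Jb z)) (JM (b z) _ Jq); congr J; ring.
Qed.

(** Adjoining a suitable ['X_i - a_i] for one variable after another keeps the ideal proper. Modulo
    the result every [f] is congruent to the constant [f.@[a]], which must be 0 when [f] is in
    [J]. *)
Theorem weak_nullstellensatz (J : A -> Prop) :
  is_ideal J -> ~ J 1 -> exists a : 'I_n -> F, forall f, J f -> f.@[a] = 0.
Proof.
move=> J_ideal J1.
have [J' [J'_ideal J'1 sub J'X]] : exists J' : A -> Prop,
    [/\ is_ideal J', ~ J' 1, forall f, J f -> J' f
      & forall i, i \in enum 'I_n -> exists a, J' ('X_i - a%:A)].
  elim: (enum 'I_n) => [|i s [J' [J'_ideal J'1 sub J'X]]]; first by exists J.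
  have [a Ja] := ideal_adjoin_proper 'X_i J'_ideal J'1.
  exists (ideal_adjoin J' ('X_i - a%:A)); split=> //.
  - exact: ideal_adjoin_ideal.
  - by move=> f /sub; apply: ideal_adjoin_sub.
  move=> j; rewrite inE => /predU1P[->|/J'X[a' J'a']].
    by exists a; apply: ideal_adjoin_gen.
  by exists a'; apply: ideal_adjoin_sub.
have {}J'X i : exists a, J' ('X_i - a%:A) by apply: J'X; rewrite mem_enum.
have [a J'a] := choice J'X; exists a => f /sub J'f.
have [J0 JD JM] := J'_ideal.
pose K (f : A) := J' (f - f.@[a]%:A).
have KM g h : K g -> K h -> K (g * h).
  move=> Kg Kh; have := JD _ _ (JM h _ Kg) (JM (g.@[a]%:A) _ Kh); congr J'.
  by rewrite mevalM -!mul_mpolyC mpolyCM; ring.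
have K1 : K 1 by rewrite /K meval1 scale1r subrr.
have K_all : K f.
  rewrite [f]mpolyE; apply: (big_ind K).
  - by rewrite /K meval0 scale0r subrr.
  - move=> g h Kg Kh; have := JD _ _ Kg Kh; congr J'.
    by rewrite mevalD scalerDl; ring.
  move=> m _; rewrite -mul_mpolyC; apply: (KM).
    by rewrite /K mevalC -mul_mpolyC mulr1 subrr.
  rewrite mpolyXE_id; apply: (big_ind K K1 KM) => i _.
  elim: (m i) => [|k IHk]; first by rewrite expr0.
  by rewrite exprS; apply: (KM); rewrite // /K mevalXU.
apply: contrapT => /eqP fa; apply: J'1.
have := JM ((f.@[a])^-1%:A) _ (JD _ _ J'f (JM (-1) _ K_all)); congr J'.
by rewrite -!mul_mpolyC mulN1r opprB addrC subrK !mulr1 -mpolyCM mulVf // mpolyC1.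
Qed.

End Nullstellensatz.

(** * Uncountability of the complex numbers *)

Section Uncountable.
Variable R : realType.

Lemma interval_avoid_seq (s : seq R) (a b : R) : a < b ->
  exists p : R * R, [/\ a <= p.1, p.1 < p.2, p.2 <= b
    & forall x, p.1 <= x <= p.2 -> x \notin s].
Proof.
move=> ab; elim: s => [|y s [[a1 b1] /= [aa1 ab1 b1b s_out]]].
  by exists (a, b); split.
have [y_mid|mid_y] := leP y ((a1 + b1) / 2).
  (* The right quarter instead of the right half: the closed interval must exclude [y] even when [y]
     is the midpoint. *)
  exists ((a1 + b1 *+ 3) / 4, b1); rewrite /= mulrSr mulr2n.
  split=> //; [lra|lra|move=> x /andP[x1 x2]].
  rewrite inE negb_or s_out ?andbT; last by rewrite x2 andbT; lra.
  by apply/eqP=> xy; move: y_mid x1; rewrite xy; lra.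
exists (a1, (a1 + b1) / 2); rewrite /=; split=> //; [lra|lra|move=> x /andP[x1 x2]].
rewrite inE negb_or s_out ?andbT; last by rewrite x1 /=; lra.
by apply/eqP=> xy; move: mid_y x2; rewrite xy; lra.
Qed.

(** Cantor's nested intervals: step [m] avoids [s m], and the supremum of the left endpoints lies in
    every interval. *)
Lemma real_not_union_finite (s : nat -> seq R) :
  exists x, forall m, x \notin s m.
Proof.
have next (q : nat * (R * R)) : exists p : R * R, q.2.1 < q.2.2 ->
    [/\ q.2.1 <= p.1, p.1 < p.2, p.2 <= q.2.2
      & forall x, p.1 <= x <= p.2 -> x \notin s q.1].
  have [/(interval_avoid_seq (s q.1))[p Hp]|_] := boolP (q.2.1 < q.2.2).
    by exists p.
  by exists q.2.
have [f Hf] := choice next.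
pose I := fix I m : R * R := if m is m'.+1 then f (m', I m') else (0, 1).
have I_lt m : (I m).1 < (I m).2.
  by elim: m => [|m IHm] /=; [rewrite ltr01 | have [] := Hf (m, I m) IHm].
have I_step m := Hf (m, I m) (I_lt m).
have I_mono m k : (m <= k)%N -> (I m).1 <= (I k).1 /\ (I k).2 <= (I m).2.
  move=> /subnK <-; elim: (k - m)%N => [|j [IH1 IH2]] //=.
  have [/= le1 _ le2 _] := I_step (j + m)%N.
  by split; [apply: le_trans le1 | apply: le_trans IH2].
pose E : set R := fun x => exists m, x = (I m).1.
have E_ub m : ubound E (I m).2.
  move=> _ [k ->]; have [km|mk] := leqP k m.
    by apply: (le_trans _ (ltW (I_lt m))); case: (I_mono _ _ km).
  by apply: (le_trans (ltW (I_lt k))); case: (I_mono _ _ (ltnW mk)).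
have E_sup : has_sup E by split; [exists (I 0%N).1; exists 0%N | exists (I 0%N).2].
exists (sup E) => m; have [_ _ _] := I_step m; apply; apply/andP; split.
  by apply: sup_upper_bound => //; exists m.+1.
by apply: (ge_sup _ (E_ub m.+1)); exists (I 0%N).1; exists 0%N.
Qed.

(** The real points suffice: otherwise each level [g <= d] on them is finite, and the reals are a
    countable union of finite sets. *)
Lemma complex_large_fibers : large_fibers R[i].
Proof.
move=> g; apply: contrapT => nofib.
have cover d : exists s : seq R, forall x : R, (g x%:C%C <= d)%N -> x \in s.
  apply: contrapT => /forallNP nocov; case: nofib; exists d => N.
  suff [s [us sN sd]] : exists s : seq R,
      [/\ uniq s, size s = N & forall x, x \in s -> (g x%:C%C <= d)%N].
    exists [seq x%:C%C | x <- s]; rewrite size_map map_inj_uniq //.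
      by split=> // _ /mapP[x xs ->]; apply: sd.
    by move=> x y [].
  elim: N => [|N [s [us sN sd]]]; first by exists [::].
  have /existsNP[x /not_implyP[xd /negP xs]] := nocov s.
  exists (x :: s); rewrite /= xs us sN; split=> // y.
  by rewrite inE => /predU1P[->|/sd].
have [s s_cov] := choice cover.
have [x x_out] := real_not_union_finite s.
by have := s_cov (g x%:C%C) x (leqnn _); rewrite (negPf (x_out _)).
Qed.

End Uncountable.

(** * Homogeneous components of polynomials *)

Section Grading.
Variables (F : fieldType) (n : nat).
Notation A := {mpoly F[n]}.

(* [grade f] is [f] with every [X_i] multiplied by a new variable, so that its
   coefficients are the homogeneous components of [f]. *)
Definition grade : A -> {poly A} :=
  mmap (polyC \o @mpolyC n F) (fun i => ('X_i)%:P * 'X).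

Definition homogeneous d (f : A) := grade f = f%:P * 'X^d.

Lemma gradeX m : grade 'X_[m] = ('X_[m])%:P * 'X^(mdeg m).
Proof.
rewrite /grade mmapX /mmap1 mpolyXE_id mdegE rmorph_prod -prodrXr -big_split.
by apply: eq_bigr => i _; rewrite exprMn rmorphXn.
Qed.

Lemma gradeZ a f : grade (a *: f) = (a%:MP)%:P * grade f.
Proof. by rewrite /grade mmapZ. Qed.

Lemma gradeM f g : grade (f * g) = grade f * grade g.
Proof. exact: rmorphM. Qed.

Lemma gradeB f g : grade (f - g) = grade f - grade g.
Proof. exact: rmorphB. Qed.

Lemma grade1 : grade 1 = 1.
Proof. exact: rmorph1. Qed.

Lemma grade_sum (I : Type) (r : seq I) (f : I -> A) :
  grade (\sum_(i <- r) f i) = \sum_(i <- r) grade (f i).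
Proof. exact: raddf_sum. Qed.

Lemma homogeneousX i : homogeneous 1 'X_i.
Proof. by rewrite /homogeneous gradeX mdeg1. Qed.

Lemma homogeneousB d f g :
  homogeneous d f -> homogeneous d g -> homogeneous d (f - g).
Proof. by rewrite /homogeneous gradeB => -> ->; rewrite -mulrBl rmorphB. Qed.

Lemma homogeneousM d d' f g :
  homogeneous d f -> homogeneous d' g -> homogeneous (d + d') (f * g).
Proof.
by rewrite /homogeneous gradeM => -> ->; rewrite mulrACA -exprD rmorphM.
Qed.

Lemma homogeneousZ d a f : homogeneous d f -> homogeneous d (a *: f).
Proof.
by rewrite /homogeneous gradeZ => ->; rewrite mulrA -rmorphM mul_mpolyC.
Qed.

Lemma homogeneous_sum d (I : finType) (f : I -> A) :
  (forall i, homogeneous d (f i)) -> homogeneous d (\sum_i f i).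
Proof.
move=> fd; rewrite /homogeneous grade_sum rmorph_sum mulr_suml.
by apply: eq_bigr => i _; rewrite fd.
Qed.

(** Only the degree [d] parts of the [a i] reach degree [d + e], so the coefficients expressing a
    form in the ideal may be taken homogeneous. *)
Lemma grade_coef_sum d e (I : finType) (a f : I -> A) :
  (forall i, homogeneous e (f i)) ->
  (grade (\sum_i a i * f i))`_(d + e) = \sum_i (grade (a i))`_d * f i.
Proof.
move=> fe; rewrite grade_sum coef_sum; apply: eq_bigr => i _.
by rewrite gradeM fe mulrA coefMXn ltnNge leq_addl /= addnK coefMC.
Qed.

(** The bound [d.+1] makes this a finite type, which can index sums and matrices. *)
Definition monomial d := {m : 'X_{1..n < d.+1} | mdeg m == d}.

Lemma grade_coef_monomials d f : exists c : monomial d -> F,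
  (grade f)`_d = \sum_t c t *: 'X_[val t : 'X_{1..n < d.+1}].
Proof.
rewrite {1}[f]mpolyE grade_sum coef_sum.
apply: (big_ind (fun g => exists c : monomial d -> F,
  g = \sum_t c t *: 'X_[val t : 'X_{1..n < d.+1}])) => [|g h [c1 ->] [c2 ->]|m _].
- by exists (fun=> 0); rewrite big1 // => t _; rewrite scale0r.
- exists (fun t => c1 t + c2 t); rewrite -big_split.
  by apply: eq_bigr => t _; rewrite scalerDl.
rewrite gradeZ gradeX mulrA -rmorphM coefMXn coefC.
have [dm|/negPf md] := eqVneq (mdeg m) d; last first.
  exists (fun=> 0); rewrite big1 => [|t _]; last by rewrite scale0r.
  case: ltnP => // le_md; rewrite subn_eq0 [(d <= _)%N]leqNgt ltn_neqAle md.
  by rewrite le_md.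
have m_d : (mdeg m < d.+1)%N by rewrite dm.
pose t0 : monomial d := exist _ (BMultinom m_d) (introT eqP dm).
exists (fun t => if t == t0 then f@_m else 0).
rewrite (bigD1 t0) //= eqxx big1 => [|t /negPf ->]; last by rewrite scale0r.
by rewrite dm ltnn subnn addr0 /= mul_mpolyC.
Qed.

End Grading.

(** * Homogeneous Nullstellensatz and elimination *)

Section HomogeneousNullstellensatz.
Variables (F : closedFieldType) (n e : nat) (I : finType).
Variable f : I -> {mpoly F[n]}.
Hypotheses (F_large : large_fibers F) (f_homog : forall i, homogeneous e (f i)).
Hypothesis f_zero : forall a : 'I_n -> F,
  (forall i, (f i).@[a] = 0) -> forall j, a j = 0.
Notation A := {mpoly F[n]}.

Definition generated_ideal (g : A) := exists b : I -> A, g = \sum_i b i * f i.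

Lemma generated_ideal_ideal : is_ideal generated_ideal.
Proof.
split=> [|_ _ [b1 ->] [b2 ->]|h _ [b ->]].
- by exists (fun=> 0); rewrite big1 // => i _; rewrite mul0r.
- exists (fun i => b1 i + b2 i); rewrite -big_split.
  by apply: eq_bigr => i _; rewrite mulrDl.
- exists (fun i => h * b i); rewrite mulr_sumr.
  by apply: eq_bigr => i _; rewrite mulrA.
Qed.

Lemma generated_ideal_gen i : generated_ideal (f i).
Proof.
exists (fun j => (j == i)%:R); rewrite (bigD1 i) //= eqxx mul1r big1 ?addr0 //.
by move=> j /negPf->; rewrite mul0r.
Qed.

(** The forms and ['X_j - 1] have no common zero, so 1 is congruent to [h * ('X_j - 1)]. The ideal
    being homogeneous, this holds in each degree, and inductively ['X_j ^+ k] is congruent to minus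
    the degree [k] part of [h], which is 0 for large [k]. *)
Lemma generated_ideal_power1 j : exists N, generated_ideal ('X_j ^+ N).
Proof.
have gI := generated_ideal_ideal; have [g0 gD gM] := gI.
have [h [b Eb]] : ideal_adjoin generated_ideal ('X_j - 1) 1.
  apply: contrapT => adj1.
  have adjI := ideal_adjoin_ideal gI ('X_j - 1).
  have [a Ha] := weak_nullstellensatz F_large adjI adj1.
  have aj : a j = 0.
    by apply: f_zero => i; apply: Ha; apply: ideal_adjoin_sub (generated_ideal_gen i).
  have := Ha _ (ideal_adjoin_gen gI _).
  by rewrite mevalB mevalXU meval1 aj sub0r => /eqP; rewrite oppr_eq0 oner_eq0.
have coefI k : generated_ideal (grade (1 - h * ('X_j - 1)))`_k.
  rewrite Eb grade_sum coef_sum; apply: (ideal_sum gI) => i.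
  rewrite gradeM f_homog mulrA coefMXn.
  by case: ltnP => // _; rewrite coefMC; apply: gM; apply: generated_ideal_gen.
rewrite gradeB grade1 gradeM gradeB grade1 homogeneousX expr1 in coefI.
set H := grade h in coefI.
have powI k : generated_ideal ('X_j ^+ k + H`_k).
  elim: k => [|k IHk].
    have := coefI 0%N; congr generated_ideal.
    by rewrite mulrBr mulr1 mulrA !coefB coefMX coef1 eqxx expr0 /= sub0r opprK.
  have := gD _ _ (coefI k.+1) (gM 'X_j _ IHk); congr generated_ideal.
  rewrite mulrBr mulr1 mulrA !coefB coefMX coefMC coef1 /= exprS; ring.
by exists (size H); have := powI (size H); rewrite nth_default // addr0.
Qed.

(** With [N] the largest exponent given by [generated_ideal_power1], a monomial of degree above
    [n * N] has some exponent that reaches [N]. *)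
Lemma homogeneous_nullstellensatz : exists N, forall m : 'X_{1..n},
  (n * N < mdeg m)%N -> generated_ideal 'X_[m].
Proof.
have [g0 gD gM] := generated_ideal_ideal.
have [N HN] := choice generated_ideal_power1.
exists (\max_j N j) => m m_big.
have [j Nj] : exists j, (N j <= m j)%N.
  apply/existsP; apply: contraLR m_big => /existsPn m_lt.
  rewrite -leqNgt mdegE -[n in (n * _)%N]card_ord -sum_nat_const.
  apply: leq_sum => j _; apply: leq_trans (leq_bigmax j).
  by rewrite leqNgt; apply: contra (m_lt j); apply: ltnW.
rewrite -[m](@submK _ (U_(j) *+ N j)%MM).
  by rewrite mpolyXD -mpolyXn; apply: gM; apply: HN.
apply/mnm_lepP => i; rewrite mulmnE mnm1E.
by case: eqP => [<-|_]; rewrite ?mul1n ?mul0n.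
Qed.

End HomogeneousNullstellensatz.

(* [(1 - t) N] fixes [v] modulo [t ^ K], so [det (1 - (1 - t) N)], which is [1]
   at [t = 1], kills [v] modulo [t ^ K]. *)
Lemma det_annihilates (F : fieldType) (T : finType) (N : T -> T -> F) :
  exists2 p : {poly F}, p != 0 & forall K (v : T -> {poly F}),
    (forall a, 'X^K %| v a - (1 - 'X) * \sum_b (N a b)%:P * v b) ->
    forall a, 'X^K %| p * v a.
Proof.
pose M : 'M[{poly F}]_#|T| := 1%:M -
  (1 - 'X) *: \matrix_(i, j) (N (enum_val i) (enum_val j))%:P.
exists (\det M).
  apply: contra_eq_neq (oner_neq0 F) => /= M0.
  have := congr1 (horner^~ 1) M0; rewrite horner0 -horner_evalE -det_map_mx.
  rewrite (_ : map_mx _ M = 1%:M) ?det1 => [/eqP|]; first by rewrite oner_eq0.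
  apply/matrixP=> i j; rewrite !mxE /= horner_evalE.
  by rewrite !hornerE subrr mul0r subr0; case: (i == j); rewrite !hornerE.
move=> K v v_fix a.
pose V : 'cV[{poly F}]_#|T| := \col_i v (enum_val i).
have MV i : 'X^K %| (M *m V) i 0.
  rewrite mulmxBl mul1mx -scalemxAl !mxE.
  rewrite (reindex_onto enum_rank enum_val) /=; last by move=> *; apply: enum_valK.
  have := v_fix (enum_val i); congr (_ %| _); congr (_ - _ * _).
  apply: eq_big => [b|b _]; first by rewrite enum_rankK eqxx.
  by rewrite !mxE enum_rankK.
have := mul_adj_mx M; move/(congr1 (fun B => B *m V)).
rewrite -mulmxA mul_scalar_mx => /matrixP/(_ (enum_rank a) 0).
rewrite [RHS]mxE [V _ _]mxE enum_rankK => <-; rewrite mxE.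
by apply: (big_ind (fun q => 'X^K %| q)) => [|x y|k _];
  [apply: dvdp0 | apply: dvdp_add | apply: dvdp_mull].
Qed.

(* If [f] has no common zero, then neither has [f - (1 - t) g] over [F((t))],
   with an elimination that is uniform in the precision [t ^ K]. *)
Lemma homogeneous_elimination (F : closedFieldType) (n e : nat) (I : finType)
    (f g : I -> {mpoly F[n]}) :
  large_fibers F ->
  (forall i, homogeneous e (f i)) -> (forall i, homogeneous e (g i)) ->
  (forall a : 'I_n -> F, (forall i, (f i).@[a] = 0) -> forall j, a j = 0) ->
  exists d, exists2 p : {poly F}, p != 0 &
    forall K (x : 'I_n -> {poly F}),
      (forall i, 'X^K %| mmap polyC x (f i) - (1 - 'X) * mmap polyC x (g i)) ->
      forall j, 'X^K %| p * x j ^+ d.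
Proof.
move=> F_large f_homog g_homog f_zero.
have [M HM] := homogeneous_nullstellensatz F_large f_homog f_zero.
have [d Md] : exists d, (n * M < d + e)%N by exists (n * M).+1; rewrite ltn_addr.
pose X (t : monomial n (d + e)) : {mpoly F[n]} :=
  'X_[val t : 'X_{1..n < (d + e).+1}].
have mon_f t : exists b, X t = \sum_i b i * f i.
  by apply: HM; rewrite (eqP (valP t)).
have [b Hb] := choice mon_f.
(* Replacing [f] by [g] in the expression of each monomial and keeping the part of degree [d + e]
   gives the matrix [N]. *)
have [N HN] := choice (fun t =>
  grade_coef_monomials (d + e) (\sum_i b t i * g i)).
have [p p_n0 Hp] := det_annihilates N.
exists (d + e)%N, p => // K x x_fg j.
pose psi := mmap (@polyC F) x.
have psiM : {morph psi : h k / h * k} by apply: rmorphM.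
have psi_sum (J : finType) (h : J -> {mpoly F[n]}) :
    psi (\sum_j h j) = \sum_j psi (h j).
  exact: raddf_sum.
(* Modulo [t ^ K] the values of [f] are [1 - t] times those of [g], so the values of the monomials
   form a fixed vector of [(1 - t) N]. *)
have psi_mon t : 'X^K %| psi (X t) - (1 - 'X) * \sum_s (N t s)%:P * psi (X s).
  have Eb : X t = \sum_i (grade (b t i))`_d * f i.
    rewrite -(grade_coef_sum d (b t) f_homog) -Hb gradeX (eqP (valP t)).
    by rewrite coefMXn ltnn subnn coefC.
  have -> : \sum_s (N t s)%:P * psi (X s) =
      \sum_i psi (grade (b t i))`_d * psi (g i).
    have Eg := etrans (esym (HN t)) (grade_coef_sum d (b t) g_homog).
    transitivity (psi (\sum_s N t s *: X s)).
      by apply/esym/(etrans (psi_sum _ _))/eq_bigr => s _; apply: mmapZ.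
    apply: (etrans (congr1 psi Eg)); apply/(etrans (psi_sum _ _))/eq_bigr => i _.
    exact: psiM.
  rewrite Eb psi_sum mulr_sumr -sumrB.
  apply: (big_ind (fun q => 'X^K %| q)) => [|h k|i _];
    [exact: dvdp0 | exact: dvdp_add |].
  by rewrite psiM mulrCA -mulrBr; apply: dvdp_mull; apply: x_fg.
have m_deg : mdeg (U_(j) *+ (d + e))%MM = (d + e)%N.
  by rewrite mdegMn mdeg1 mul1n.
have m_lt : (mdeg (U_(j) *+ (d + e))%MM < (d + e).+1)%N by rewrite m_deg.
have := Hp K _ psi_mon (exist _ (BMultinom m_lt) (introT eqP m_deg)).
by rewrite /X /= -mpolyXn /psi rmorphXn /= mmapX mmap1U.
Qed.

(** * Quadratic eigenvectors by Hensel lifting *)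

Section QuadraticEigenvector.
Variables (F : closedFieldType) (n : nat) (c : 'I_n.+1 -> 'I_n.+1 -> 'I_n.+1 -> F).
Notation A := {mpoly F[n.+1]}.

(** Coefficients pass through [f] so that one formula takes values in [F], in [{poly F}] and in
    [{mpoly F[n.+1]}]. *)
Definition quad (B : comNzRingType) (f : F -> B) (x : 'I_n.+1 -> B) i : B :=
  \sum_a \sum_b f (c i a b) * (x a * x b).

(* Hensel lifting along [(1 - t) x_i ^ 2 + t q_i(x) = x_i] from [x = (1, ..., 1)]
   at [t = 0], where the differential of [x_i ^ 2 - x_i] is the identity. *)
Lemma quad_hensel K : exists e : 'I_n.+1 -> {poly F}, forall i,
  'X %| e i - 1 /\
  'X^K %| (1 - 'X) * e i ^+ 2 + 'X * quad polyC e i - e i.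
Proof.
suff [e He] : exists e : 'I_n.+1 -> {poly F}, forall i, 'X %| e i - 1 /\
    'X^(K.+1) %| (1 - 'X) * e i ^+ 2 + 'X * quad polyC e i - e i.
  exists e => i; have [-> HK] := He i; split=> //.
  by apply: dvdp_trans HK; rewrite exprS dvdp_mulIr.
elim: K => [|K [e He]].
  exists (fun=> 1) => i; rewrite subrr dvdp0; split=> //.
  rewrite expr1n mulr1 (_ : _ - _ = 'X * (quad polyC (fun=> 1) i - 1)).
    by rewrite expr1 dvdp_mulIl.
  ring.
pose r i := (1 - 'X) * e i ^+ 2 + 'X * quad polyC e i - e i.
have rK i : 'X^(K.+1) %| r i by have [] := He i.
(* Newton step: subtracting the residue [r] gains one power of [t], because the differential is the
   identity modulo [t]. *)
exists (fun i => e i - r i) => i; have [eX _] := He i.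
have r1 j : 'X %| r j by apply: dvdp_trans (rK j); rewrite exprS dvdp_mulIl.
split; first by rewrite addrAC dvdp_sub.
have qK : 'X^(K.+1) %| quad polyC (fun j => e j - r j) i - quad polyC e i.
  rewrite /quad -sumrB.
  apply: (big_ind (fun q => 'X^(K.+1) %| q)) => [|x y|a _];
    [exact: dvdp0 | exact: dvdp_add | rewrite -sumrB].
  apply: (big_ind (fun q => 'X^(K.+1) %| q)) => [|x y|b _];
    [exact: dvdp0 | exact: dvdp_add |].
  rewrite -mulrBr; apply: dvdp_mull.
  rewrite (_ : _ - _ = - ((e a - r a) * r b + e b * r a)); last by ring.
  by rewrite dvdpNr dvdp_add ?dvdp_mull.
rewrite (_ : _ - _ = - (2 * ((e i - 1) * r i)) + 2 * (e i * ('X * r i))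
    + (1 - 'X) * (r i * r i)
    + 'X * (quad polyC (fun j => e j - r j) i - quad polyC e i)); last first.
  by rewrite /r; ring.
rewrite exprS; apply: dvdp_add; last exact: dvdp_mul.
apply: dvdp_add; last by apply: dvdp_mull; apply: dvdp_mul.
apply: dvdp_add; first by rewrite dvdpNr; apply: dvdp_mull; apply: dvdp_mul.
by apply: dvdp_mull; apply: dvdp_mull; apply: dvdp_mul.
Qed.

Lemma quad_eigenvector : large_fibers F ->
  exists2 x : 'I_n.+1 -> F, (exists i, x i != 0) &
    forall k j, x k * quad id x j = x j * quad id x k.
Proof.
move=> F_large; apply: contrapT => no_eig.
pose q i : A := quad (@mpolyC n.+1 F) (fun j => 'X_j) i.
pose f (kj : 'I_n.+1 * 'I_n.+1) : A := 'X_kj.1 * q kj.2 - 'X_kj.2 * q kj.1.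
(* The same cubics for the squares [x_i ^ 2]: [f - (1 - t) (f - f0)] leads from [f0] at [t = 0] to
   [f] at [t = 1]. *)
pose f0 (kj : 'I_n.+1 * 'I_n.+1) : A :=
  'X_kj.1 * 'X_kj.2 ^+ 2 - 'X_kj.2 * 'X_kj.1 ^+ 2.
have X_homog := @homogeneousX F n.+1.
have q_homog i : homogeneous 2 (q i).
  apply: homogeneous_sum => a; apply: homogeneous_sum => b.
  rewrite mul_mpolyC; apply: homogeneousZ.
  exact: (homogeneousM (X_homog a) (X_homog b)).
have f_homog kj : homogeneous 3 (f kj).
  by apply: homogeneousB; apply: homogeneousM (X_homog _) (q_homog _).
have f0_homog kj : homogeneous 3 (f0 kj).
  by apply: homogeneousB; rewrite expr2; apply: homogeneousM (X_homog _)
    (homogeneousM (X_homog _) (X_homog _)).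
have f_zero (a : 'I_n.+1 -> F) : (forall kj, (f kj).@[a] = 0) -> forall j, a j = 0.
  move=> fa j; apply: contrapT => /eqP aj; apply: no_eig.
  exists a; first by exists j.
  have qa i : (q i).@[a] = quad id a i.
    rewrite raddf_sum; apply: eq_bigr => k _; rewrite raddf_sum.
    by apply: eq_bigr => l _; rewrite /= !mevalM mevalC !mevalXU.
  move=> k l; have /eqP := fa (k, l).
  by rewrite mevalB !mevalM !mevalXU !qa subr_eq0 => /eqP.
have [d [p p_n0 Hp]] := homogeneous_elimination F_large f_homog
  (fun kj => homogeneousB (f_homog kj) (f0_homog kj)) f_zero.
(* With this [K], [t ^ K] cannot divide [p * e_0 ^ d]: since [e_0] has constant term 1, it would
   divide [p], whose degree is less than [K]. *)
pose K := size p.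
have [e He] := quad_hensel K.
pose psi := mmap (@polyC F) e.
have psiB : {morph psi : g h / g - h} by apply: mmapB.
have psiM : {morph psi : g h / g * h} by apply: rmorphM.
have psi_sum (J : finType) (g : J -> A) : psi (\sum_j g j) = \sum_j psi (g j).
  exact: raddf_sum.
have psiX i : psi 'X_i = e i by rewrite /psi mmapX mmap1U.
have psiq i : psi (q i) = quad polyC e i.
  rewrite psi_sum; apply: eq_bigr => k _; rewrite psi_sum.
  by apply: eq_bigr => l _; rewrite !psiM !psiX /psi mmapC.
(* The quadratic map at parameter [t] fixes [e] modulo [t ^ K], so its cubics at [e] reduce to
   [e_k e_j - e_j e_k = 0]. *)
have psi_f kj : 'X^K %| psi (f kj) - (1 - 'X) * psi (f kj - f0 kj).
  have [_ H1] := He kj.1; have [_ H2] := He kj.2.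
  have := dvdp_sub (dvdp_mull (e kj.1) H2) (dvdp_mull (e kj.2) H1).
  by congr (_ %| _); rewrite !(psiB, psiM, psiX, psiq); ring.
have := Hp K e psi_f ord0; rewrite Gauss_dvdpl; last first.
  apply: coprimep_expl; apply: coprimep_expr.
  rewrite coprimep_sym -['X]subr0 coprimep_XsubC /root.
  have [/dvdpP[u Eu] _] := He ord0.
  by rewrite -[e ord0](subrK 1) Eu !hornerE ?mulr0 ?add0r oner_neq0.
by move/(dvdp_leq p_n0); rewrite size_polyXn ltnn.
Qed.

End QuadraticEigenvector.

(** * Idempotents in the image of an operator, and the conclusion *)

(** In a basis of the image, a quadratic eigenvector gives [v v = s v] with [s] nonzero by
    anisotropy, and [v / s] is idempotent. *)
Lemma image_idempotent (F : closedFieldType) (n : nat)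
    (mu : 'rV[F]_n -> 'rV[F]_n -> 'rV[F]_n) (D : 'M[F]_n) :
  large_fibers F -> bilinear_mul mu -> (forall v, mu v v = 0 -> v = 0) ->
  (forall x y, (mu (x *m D) (y *m D) <= D)%MS) -> D != 0 ->
  exists2 x, x *m D != 0 & mu (x *m D) (x *m D) = x *m D.
Proof.
move=> F_large mu_bil mu_aniso mu_D D_n0.
have : \rank D != 0%N by rewrite mxrank_eq0.
move: (row_base D) (eq_row_base D) (row_base_free D).
case: (\rank D) => // m B BD B_free _.
have BE (x : 'rV_m.+1) : exists z, x *m B = z *m D.
  by apply/submxP; rewrite (submx_trans (submxMl _ _)) // BD.
have mu_B (x y : 'rV_m.+1) : (mu (x *m B) (y *m B) <= B)%MS.
  by have [[z ->] [t ->]] := (BE x, BE y); rewrite BD.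
pose c i a b := (mu (row a B) (row b B) *m pinvmx B) 0 i.
have [x [k xk] x_eig] := quad_eigenvector c F_large.
pose v := \row_i x i.
have vE i : v 0 i = x i by rewrite mxE.
have v_n0 : v != 0.
  by apply: contra_neq xk => v0; rewrite -vE v0 mxE.
have quadE i : quad c id x i = (mu (v *m B) (v *m B) *m pinvmx B) 0 i.
  rewrite (mulmx_sum_row v) (bilinear_mul_suml mu_bil) mulmx_suml summxE.
  apply: eq_bigr => a _; rewrite (bilinear_mul_sumr mu_bil) mulmx_suml summxE.
  apply: eq_bigr => b _; rewrite (bilinear_mulZl mu_bil) (bilinear_mulZr mu_bil).
  by rewrite -!scalemxAl scalerA [RHS]mxE !vE mulrC.
pose s := quad c id x k / x k.
have vv : mu (v *m B) (v *m B) = s *: (v *m B).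
  rewrite -(mulmxKpV (mu_B v v)) scalemxAl; congr (_ *m B).
  apply/rowP=> i; rewrite -quadE !mxE; apply: (mulfI xk).
  by rewrite x_eig /s [RHS]mulrA [x k * _]mulrC divfK // mulrC.
have vB_n0 : v *m B != 0.
  by apply: contra_neq v_n0 => vB0; apply: (row_free_inj B_free); rewrite vB0 mul0mx.
have s_n0 : s != 0.
  apply: contra_neq vB_n0 => s0; apply: mu_aniso.
  by rewrite vv s0 scale0r.
have [z Ez] := BE (s^-1 *: v); exists z; rewrite -Ez -scalemxAl.
  by rewrite scaler_eq0 invr_eq0 negb_or s_n0.
rewrite (bilinear_mulZl mu_bil) (bilinear_mulZr mu_bil) vv !scalerA.
by rewrite -mulrA mulVf // mulr1.
Qed.

Theorem theorem10p8 (R : realType) (n : nat) (mu : 'rV[R[i]]_n -> 'rV[R[i]]_n -> 'rV[R[i]]_n) :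
  bilinear_mul mu -> commutative_mul mu ->
  ~ in_D1 mu -> ~ in_D2 mu ->
  forall D : 'M[R[i]]_n, quasiderivation mu D -> D = 0.
Proof.
move=> mu_bil mu_comm mu_D1 mu_D2 D D_quasi.
have mu_aniso v : mu v v = 0 -> v = 0.
  by move=> vv; apply: contrapT => /eqP v_n0; apply: mu_D1; exists v.
have D2 : D *m D = 0.
  (* Dimension 0 is treated apart, since powers of [D] are taken in the ring of matrices of size
     [n.+1]. *)
  case: n mu mu_bil mu_aniso D D_quasi {mu_comm mu_D1 mu_D2} =>
    [|n] mu mu_bil mu_aniso D D_quasi.
    by rewrite [D]flatmx0 mul0mx.
  exact: quasiderivation_sqr0 mu_bil D_quasi mu_aniso.
apply: contrapT => /eqP D_n0; apply: mu_D2.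
have mu_D x y : (mu (x *m D) (y *m D) <= D)%MS.
  by rewrite (quasiderivation_sqr0_mul mu_bil D_quasi D2) submxMl.
have [x xD xDxD] :=
  image_idempotent (@complex_large_fibers R) mu_bil mu_aniso mu_D D_n0.
exact: image_idempotent_in_D2 mu_bil mu_comm D_quasi D2 x xD xDxD.
Qed.
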